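(* Let $\sigma>0$, $\alpha\in(1,2)$ and $s^\star=\sqrt{\alpha(2-\alpha)}$, and let $\lambda^\star(\beta)=\mathcal B_S^{-1}(\beta)$ be as defined in the context. For each $\beta\in(0,\tfrac12)$, every sequence of positive reals $(\Delta_n)_{n\ge1}$ and every sequence of measurable estimators $\mu_n:\mathbb R^n\to\mathbb R$ with $\beta_n(\mu_n;\Delta_n)\le\beta$ for all $n$, $$\liminf_{n\to\infty}\,n^{(\alpha-1)/\alpha}\,\frac{\Delta_n}{\sigma}\;\ge\;s^\star\,\bigl(2\lambda^\star(\beta)\bigr)^{(\alpha-1)/\alpha}.$$
   Context: For $\mu\in\mathbb R$, $\mathcal C_\mu$ is the set of Borel probability measures $P$ on $\mathbb R$ with $\int x\,dP=\mu$ and $\int|x-\mu|^\alpha\,dP\le\sigma^\alpha$. The worst-case confidence level of an estimator $\mu_n=\mu_n(X_1,\dots,X_n)$ at margin $\Delta>0$ is $$\beta_n(\mu_n;\Delta)=\max\Bigl\{\sup_{\mu\in\mathbb R,\,P_\mu\in\mathcal C_\mu}P_\mu[\mu_n>\mu+\Delta],\ \sup_{\mu\in\mathbb R,\,P_\mu\in\mathcal C_\mu}P_\mu[\mu_n<\mu-\Delta]\Bigr\},$$ where under $P_\mu$ the observations $X_1,\dots,X_n$ are i.i.d. with law $P_\mu$. For $\mu_1,\mu_2\ge0$, $\mathrm{Skellam}(\mu_1,\mu_2)$ is the law of $N_1-N_2$ with $N_1\sim\mathrm{Poisson}(\mu_1)$, $N_2\sim\mathrm{Poisson}(\mu_2)$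 independent. For $\lambda\ge0$ let $S\sim\mathrm{Skellam}(\lambda(1+s^\star),\lambda(1-s^\star))$ and $\mathcal B_S(\lambda)=P[S<0]+\tfrac12P[S=0]$. The function $\mathcal B_S$ is continuous and strictly decreasing on $[0,\infty)$ from $\mathcal B_S(0)=\tfrac12$ to $\mathcal B_S(\infty)=0$, so its inverse $\lambda^\star(\beta)=\mathcal B_S^{-1}(\beta)$ is well defined on $(0,\tfrac12)$. *)

(* Defs.v *)
From HB Require Import structures.
From mathcomp Require Import all_boot all_order all_algebra.
From mathcomp Require Import all_classical all_reals all_analysis.
From mathcomp Require Import measurable_realfun.

Set Implicit Arguments.
Unset Strict Implicit.
Unset Printing Implicit Defensive.

Import Order.TTheory GRing.Theory Num.Theory.
Import numFieldNormedType.Exports.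

Local Open Scope classical_set_scope.
Local Open Scope ring_scope.

Section tuple_cons.
Context {d : measure_display} {T : measurableType d} {n : nat}.

Definition tuple_cons (x : T * n.-tuple T) : n.+1.-tuple T :=
  [the n.+1.-tuple T of x.1 :: x.2].

Lemma measurable_tuple_cons : measurable_fun [set: T * n.-tuple T] tuple_cons.
Proof. exact: measurable_cons measurable_fst measurable_snd. Qed.

HB.instance Definition _ :=
  isMeasurableFun.Build _ _ _ _ tuple_cons measurable_tuple_cons.

End tuple_cons.

(* The [n]-fold product [P \x ... \x P], i.e. the joint law of n i.i.d.
   observations with law [P]; see [iid_lawE]. *)
Fixpoint iid_law {d : measure_display} {T : measurableType d} {R : realType}
    (P : probability T R) (n : nat) : probability (n.-tuple T) R :=
  match n with
  | 0 => \d_([tuple] : 0.-tuple T)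
  | m.+1 => distribution (P \x iid_law P m)%E tuple_cons
  end.

Lemma iid_lawE {d : measure_display} {T : measurableType d} {R : realType}
    (P : probability T R) (n : nat) (A : 'I_n -> set T) :
  (forall i, measurable (A i)) ->
  iid_law P n [set x | forall i, A i (tnth x i)] = (\prod_(i < n) P (A i))%E.
Proof.
elim: n A => [|n IHn] A mA /=.
  rewrite big_ord0 diracE mem_set//= => i; by case: i.
rewrite big_ord_recl -IHn; last by move=> i; exact: mA.
rewrite /distribution /pushforward /=.
rewrite -product_measure1E//.
  congr ((P \x iid_law P n)%E _); apply/seteqP; split => -[x t] /=.
    move=> h; split => /=; first exact: (h ord0).
    by move=> i; have := h (lift ord0 i); rewrite tnthS.
  move=> [Ax At] i; have [j ->|->] := unliftP ord0 i; last exact: Ax.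
  by rewrite tnthS; exact: At.
rewrite (_ : [set _ | _] =
    \bigcap_(i in [set: 'I_n]) ((@tnth n T ^~ i) @^-1` A (lift ord0 i))).
  apply: fin_bigcap_measurable; first exact: finite_finset.
  move=> i _; rewrite -[X in measurable X]setTI.
  exact: measurable_tnth.
by apply/seteqP; split => t /= h i; [move=> _; exact: h|exact: (h i)].
Qed.

Section worst_case_confidence.
Context {R : realType}.
Local Notation borelR := (measurableTypeR R).

(* No separate integrability condition is needed: an integral with finite value
   [mu%:E] is that of an integrable function ([+oo - +oo] is [-oo]). *)
Definition moment_class (alpha sigma mu : R) : set (probability borelR R) :=
  [set P | (\int[P]_x x%:E = mu%:E)%E /\
           (\int[P]_x (`|x - mu| `^ alpha)%:E <= (sigma `^ alpha)%:E)%E].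

Definition worst_case_level (alpha sigma : R) (n : nat)
    (m : n.-tuple borelR -> borelR) (Delta : R) : \bar R :=
  maxe
    (ereal_sup [set p | exists mu : R,
       exists2 P : probability borelR R, moment_class alpha sigma mu P &
         p = iid_law P n [set x | mu + Delta < m x]])
    (ereal_sup [set p | exists mu : R,
       exists2 P : probability borelR R, moment_class alpha sigma mu P &
         p = iid_law P n [set x | m x < mu - Delta]]).

End worst_case_confidence.

Section skellam.
Context {R : realType}.
Local Notation borelR := (measurableTypeR R).

Definition diff_nat (k : nat * nat) : borelR := k.1%:R - k.2%:R.

Lemma measurable_diff_nat : measurable_fun [set: nat * nat] diff_nat.
Proof.
have mR : measurable_fun [set: nat] (fun n => n%:R : borelR) by [].
by apply: measurable_funB; [exact: (measurableT_comp mR measurable_fst)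
                           |exact: (measurableT_comp mR measurable_snd)].
Qed.

HB.instance Definition _ :=
  isMeasurableFun.Build _ _ _ _ diff_nat measurable_diff_nat.

(* The last argument of [poisson_prob] is a dummy; [poisson_prob 0 _] is the
   Dirac mass at 0. *)
Definition skellam (mu1 mu2 : R) : probability borelR R :=
  distribution (poisson_prob mu1 0%N \x poisson_prob mu2 0%N)%E diff_nat.

Definition s_star (alpha : R) : R := Num.sqrt (alpha * (2 - alpha)).

Definition B_S (alpha lambda : R) : R :=
  let S := skellam (lambda * (1 + s_star alpha))
                   (lambda * (1 - s_star alpha)) in
  fine (S [set x | x < 0]) + 2^-1 * fine (S [set 0]).

Definition lambda_star (alpha : R) : R -> R :=
  'pinv_(fun=> 0) [set lambda : R | 0 <= lambda] (B_S alpha).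

Lemma lambda_starP (alpha beta lambda : R) :
  0 <= lambda -> B_S alpha lambda = beta ->
  0 <= lambda_star alpha beta /\ B_S alpha (lambda_star alpha beta) = beta.
Proof.
move=> l0 <-; rewrite /lambda_star.
have h : (B_S alpha @` [set l | 0 <= l]) (B_S alpha lambda) by exists lambda.
split; first exact: (@funS _ _ _ _ ('pinv_(fun=> 0) [set l | 0 <= l] (B_S alpha)) _ h).
by rewrite pinvK// inE.
Qed.

End skellam.

(* Main.v *)
(* Two laws are hidden from the estimator: the observation is [a], [-a] or [0],
   with probabilities x (1 + s) / 2, x (1 - s) / 2 and 1 - x, or with the first
   two exchanged, where x = t / n.  Their means are +mu and -mu, mu = x s a.  If
   Delta_n < mu, an estimator at level beta tests between them with total error
   at most 2 beta.  That error is at least the overlap (the sum of the pointwise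
   minima) of the two product laws, and conditioning on the number k of nonzero
   observations makes it a binomial mixture of the overlaps c_k of k biased
   signs.  As n grows the mixture becomes Poisson of parameter t, and with
   t = 2 lambda and s = s_star its value is 2 B_S(lambda).  The c_k decrease in
   k, so B_S is strictly decreasing and exceeds beta as soon as
   lambda < lambda_star(beta); hence Delta_n >= mu eventually.  Finally [a] is
   taken as large as the moment constraint allows, a ~ sigma x^(-1/alpha), and
   lambda tends to lambda_star(beta). *)
From HB Require Import structures.
Require Import Defs.
From mathcomp Require Import all_boot all_order all_algebra.
From mathcomp Require Import all_classical all_reals all_analysis.
From mathcomp Require Import measurable_realfun ring lra.
Import Order.TTheory GRing.Theory Num.Theory.
Import numFieldNormedType.Exports.
Set Implicit Arguments.
Unset Strict Implicit.
Unset Printing Implicit Defensive.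
Local Open Scope classical_set_scope.
Local Open Scope ring_scope.

(** * Overlap of two product laws *)

(** Pascal's rule. It serves both for the steps of a walk and for the number of nonzero
    observations. *)
Lemma sum_binomialS (V : nmodType) (h : nat -> nat -> V) n :
  \sum_(i < n.+2) h i (n.+1 - i)%N *+ 'C(n.+1, i) =
  \sum_(i < n.+1) h i.+1 (n - i)%N *+ 'C(n, i) +
  \sum_(i < n.+1) h i (n - i).+1 *+ 'C(n, i).
Proof.
rewrite big_ord_recl [X in _ = _ + X]big_ord_recl /= !bin0 !subn0 addrCA.
congr (_ + _).
under eq_bigr do rewrite /bump /= add1n binS mulrnDr subSS.
rewrite big_split /= addrC; congr (_ + _).
rewrite big_ord_recr /= bin_small// mulr0n addr0.
by apply: eq_bigr => i _; rewrite /bump /= add1n subnSK.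
Qed.

Section overlap.
Context {R : realType}.
Variables p q : R.
Implicit Types (u v : R) (k n : nat).

(* Sum over the k-step +-1 walks of [min (u P(walk)) (v Q(walk))], where a step
   is +1 with probability [p] under P and [q] under Q. *)
Fixpoint overlap k u v : R :=
  if k is l.+1 then overlap l (p * u) (q * v) + overlap l (q * u) (p * v)
  else Num.min u v.

(** A walk enters only through its number [i] of +1 steps, and ['C(k, i)] walks share it. *)
Lemma overlapE k u v :
  overlap k u v = \sum_(i < k.+1)
    Num.min (p ^+ i * q ^+ (k - i) * u) (p ^+ (k - i) * q ^+ i * v) *+ 'C(k, i).
Proof.
elim: k u v => [|k IHk] u v; first by rewrite big_ord1/= !mul1r.
rewrite (sum_binomialS (fun i j => Num.min (p ^+ i * q ^+ j * u)
  (p ^+ j * q ^+ i * v))) /= !IHk.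
by congr (_ + _); apply: eq_bigr => i _; congr (Num.min _ _ *+ _);
  rewrite !exprS; ring.
Qed.

Lemma overlapZ k (c : R) u v : 0 <= c ->
  overlap k (c * u) (c * v) = c * overlap k u v.
Proof.
move=> c0; elim: k u v => [|k IHk] u v /=; first by rewrite minr_pMr.
by rewrite !(mulrCA _ c) !IHk mulrDr.
Qed.

Lemma overlapD k u v u' v' :
  overlap k u v + overlap k u' v' <= overlap k (u + u') (v + v').
Proof.
elim: k u v u' v' => [|k IHk] u v u' v' /=.
  by rewrite le_min !lerD// ge_min lexx ?orbT.
rewrite !mulrDr addrACA; apply: lerD; exact: IHk.
Qed.

Lemma overlap_ge0 k u v : 0 <= p -> 0 <= q -> 0 <= u -> 0 <= v ->
  0 <= overlap k u v.
Proof.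
move=> p0 q0; elim: k u v => [|k IHk] u v u0 v0 /=; first by rewrite le_min u0.
by apply: addr_ge0; apply: IHk; exact: mulr_ge0.
Qed.

(** Forgetting the first step merges walks in pairs, which by superadditivity of the minimum
    ([overlapD]) cannot lower the overlap. *)
Lemma overlapS_le k u v : p + q = 1 -> overlap k.+1 u v <= overlap k u v.
Proof.
move=> pq1 /=; apply: le_trans (overlapD _ _ _ _ _) _.
by rewrite -!mulrDl (addrC q) pq1 !mul1r.
Qed.

(** A zero observation has the same weight [w] under both laws, so only the [k] nonzero ones enter
    the minimum. *)
Definition binomial_overlap (x w : R) n u v : R :=
  \sum_(k < n.+1) x ^+ k * w ^+ (n - k) * overlap k u v *+ 'C(n, k).

(** The three terms correspond to the value of the first observation: [a], [-a] or 0. *)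
Lemma binomial_overlapS (x w : R) n u v : 0 <= x -> 0 <= w ->
  binomial_overlap x w n.+1 u v =
  binomial_overlap x w n (x * p * u) (x * q * v) +
  binomial_overlap x w n (x * q * u) (x * p * v) +
  binomial_overlap x w n (w * u) (w * v).
Proof.
move=> x0 w0; rewrite /binomial_overlap.
rewrite (sum_binomialS (fun i j => x ^+ i * w ^+ j * overlap i u v)).
rewrite -[X in _ = X + _]big_split /=; congr (_ + _); apply: eq_bigr => i _.
  by rewrite -mulrnDl -!(mulrA x) !overlapZ// exprS; congr (_ *+ _); ring.
by rewrite overlapZ// exprS; congr (_ *+ _); ring.
Qed.

End overlap.

(** * Poisson mixtures and the function B_S *)

Section poisson_mixture.
Context {R : realType}.
Variable c : nat -> R.
Implicit Types (t : R) (K : nat).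

(** The mean of [c] under the Poisson law of parameter [t], truncated to indices below [K]. *)
Definition poisson_mix K t : R :=
  expR (- t) * \sum_(k < K) t ^+ k / k`!%:R * c k.

Lemma is_derive_exp_coeff k t :
  is_derive t 1 (fun x : R => x ^+ k.+1 / (k.+1)`!%:R) (t ^+ k / k`!%:R).
Proof.
have -> : (fun x : R => x ^+ k.+1 / (k.+1)`!%:R) =
    (k.+1)`!%:R^-1 \*: (@id R) ^+ k.+1.
  by apply/funext => x; rewrite /= fctE mulrC.
apply: is_derive_eq.
rewrite /GRing.scale /= mulr1 factS natrM invfM -mulr_natl.
have k0 : k.+1%:R != 0 :> R by rewrite pnatr_eq0.
have f0 : k`!%:R != 0 :> R by rewrite pnatr_eq0 -lt0n fact_gt0.
by field; rewrite f0 addrC natr1 k0.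
Qed.

(** As for the full Poisson mean, the derivative averages the increments of [c]; the last term is
    the boundary term left by the truncation. *)
Lemma is_derive_poisson_mix K t :
  is_derive t 1 (poisson_mix K.+1) (expR (- t) *
    (\sum_(k < K) t ^+ k / k`!%:R * (c k.+1 - c k) - t ^+ K / K`!%:R * c K)).
Proof.
have dexp : is_derive t 1 (fun x : R => expR (- x)) (- expR (- t)).
  by apply: is_derive_eq; rewrite /= mulrN1.
elim: K => [|K IHK].
  have -> : poisson_mix 1 = c 0%N \*: (fun x : R => expR (- x)).
    apply/funext => x; rewrite /poisson_mix big_ord1 fact0 /=.
    by rewrite expr0 divr1 mul1r mulrC.
  apply: is_derive_eq; rewrite big_ord0 fact0 /GRing.scale/=.
  by rewrite expr0 divr1 sub0r mul1r mulrN mulrN mulrC.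
have -> : poisson_mix K.+2 = poisson_mix K.+1 +
    c K.+1 \*: ((fun x : R => expR (- x)) *
                (fun x : R => x ^+ K.+1 / (K.+1)`!%:R)).
  apply/funext => x; rewrite /poisson_mix [in LHS]big_ord_recr/= mulrDr.
  by rewrite !fctE/= /GRing.scale/=; congr (_ + _); ring.
have dK := is_derive_exp_coeff K t.
apply: is_derive_eq; rewrite big_ord_recr/= /GRing.scale/=.
by rewrite !mulrA; ring.
Qed.

(* All terms of the derivative are nonpositive, and the one with [k = 0] is
   [(c 1 - c 0) * expR (- t)]: this gap does not depend on the truncation [K]. *)
Lemma poisson_mix_strict_decr K t t' :
  (forall k, 0 <= c k) -> (forall k, c k.+1 <= c k) -> 0 <= t -> t < t' ->
  poisson_mix K.+2 t' + (c 0%N - c 1%N) * expR (- t') * (t' - t) <=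
  poisson_mix K.+2 t.
Proof.
move=> c0 cS t0 tt'.
have [|x] := @MVT R (poisson_mix K.+2) _ t t' tt'
    (fun x _ => is_derive_poisson_mix K.+1 x).
  apply: continuous_subspaceT => x.
  apply: differentiable_continuous; apply/derivable1_diffP.
  by have [] := is_derive_poisson_mix K.+1 x.
rewrite in_itv/= => /andP[tx xt'] /eqP; rewrite subr_eq => /eqP ->.
rewrite addrAC gerDr -mulrDl.
rewrite mulr_le0_ge0 ?subr_ge0 ?(ltW tt')//.
have x0 : 0 <= x by apply: le_trans t0 (ltW tx).
rewrite -lerBrDr sub0r -[leRHS]mulNr opprB.
rewrite (@le_trans _ _ (expR (- x) * (c 1%N - c 0%N)))//; last first.
  by rewrite mulrC ler_wnM2l ?subr_le0 ?cS// ler_expR lerN2 ltW.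
rewrite ler_wpM2l ?expR_ge0// big_ord_recl /= expr0 fact0 divr1 mul1r.
rewrite -addrA gerDl subr_le0 (@le_trans _ _ 0)//.
  apply: sumr_le0 => i _; rewrite mulr_ge0_le0 ?subr_le0 ?cS//.
  by rewrite divr_ge0 ?exprn_ge0.
by rewrite mulr_ge0// divr_ge0 ?exprn_ge0.
Qed.

End poisson_mixture.

(** * The Skellam law as a Poisson mixture of overlaps *)

Section skellam_overlap.
Context {R : realType}.

Lemma poisson_prob_set1 (rate : R) i : 0 <= rate ->
  poisson_prob rate 0%N [set i] = (expR (- rate) * (rate ^+ i / i`!%:R))%:E.
Proof.
rewrite le_eqVlt /poisson_prob => /predU1P[<-|rate0].
  rewrite ltxx diracE oppr0 expR0 mul1r expr0n; congr EFin.
  case: i => [|i] /=; first by rewrite mem_set// fact0 divr1.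
  by rewrite memNset// mul0r.
by rewrite rate0 esum_set1 ?lee_fin ?poisson_pmf_ge0// /poisson_pmf rate0 mulrC.
Qed.

(** Pairs of Poisson counts are grouped by their total [k], the index of the Poisson mixture. *)
Definition skellam_partial (mu1 mu2 : R) (A : set R) (K : nat) : R :=
  \sum_(k < K) \sum_(i < k.+1)
    expR (- mu1) * (mu1 ^+ i / i`!%:R) *
    (expR (- mu2) * (mu2 ^+ (k - i) / (k - i)`!%:R)) *
    \1_A (i%:R - (k - i)%:R : R).

(** Countable additivity over the antidiagonals [F k], each cut into single points [G k i]. *)
Lemma skellam_cvg (mu1 mu2 : R) (A : set R) : 0 <= mu1 -> 0 <= mu2 ->
  measurable A ->
  skellam_partial mu1 mu2 A @ \oo --> fine (skellam mu1 mu2 A).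
Proof.
move=> mu10 mu20 mA; rewrite /skellam /distribution /pushforward.
set X := diff_nat @^-1` A.
have mX : measurable X by rewrite -[X]setTI; exact: measurable_diff_nat.
pose mu : probability (nat * nat)%type R :=
  (poisson_prob mu1 0%N \x poisson_prob mu2 0%N)%E.
pose F k := X `&` [set ij | ij.1 + ij.2 = k]%N.
pose G k i : set (nat * nat) :=
  if i%:R - (k - i)%:R \in A then [set i] `*` [set (k - i)%N] else set0.
have mG k i : measurable (G k i).
  by rewrite /G; case: ifP => // _; exact: measurableX.
have FG k : F k = \big[setU/set0]_(i < k.+1) G k i.
  rewrite -(bigcup_mkord _ (G k)); apply/seteqP; split => [[i j] [/= Xij <-]|].
    exists i; first by rewrite /= ltnS leq_addr.
    by rewrite /G addKn mem_set.
  move=> [i j] [l /= lk]; rewrite /G; case: ifP => // /set_mem Al [/= -> ->].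
  by split => //=; rewrite subnKC.
have mF k : measurable (F k) by rewrite FG; exact: bigsetU_measurable.
have muF k : mu (F k) = (\sum_(i < k.+1)
      expR (- mu1) * (mu1 ^+ i / i`!%:R) *
      (expR (- mu2) * (mu2 ^+ (k - i) / (k - i)`!%:R)) *
      \1_A (i%:R - (k - i)%:R : R))%:E.
  rewrite FG measure_semi_additive_ord//=.
  - rewrite -sumEFin; apply: eq_bigr => i _; rewrite /G indicE.
    case: ifP => _; last by rewrite measure0 mulr0.
    rewrite mulr1 /mu product_measure1E// EFinM.
    exact: congr2 (poisson_prob_set1 _ mu10) (poisson_prob_set1 _ mu20).
  - apply/trivIsetP => i j _ _ ij; apply/seteqP; split => // -[y z].
    have Gl l : G k l (y, z) -> y = l by rewrite /G; case: ifP => // _ [].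
    move=> [/Gl yi /Gl yj]; move/eqP: ij; apply.
    by apply: val_inj; rewrite /= -yi.
  - by rewrite -FG.
have XF : X = \bigcup_k F k.
  by apply/seteqP; split => [[i j] ?|[i j] [k _ []]//]; exists (i + j)%N.
have tF : trivIset setT F.
  apply/trivIsetP => i j _ _ ij; apply/seteqP; split => // -[y z] [].
  by move=> [_ /= ei] [_ /= ej]; move/eqP: ij; apply; rewrite -ei -ej.
have mXF : measurable (\bigcup_k F k) by rewrite -XF.
have /fine_cvg : (\sum_(0 <= i < K) mu (F i))%E @[K --> \oo] --> (fine (mu X))%:E.
  rewrite fineK; last exact: fin_num_measure.
  by rewrite XF; exact: measure_semi_sigma_additive.
apply: cvg_trans.
apply: near_eq_cvg; apply: nearW => K /=; rewrite big_mkord.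
by rewrite (eq_bigr _ (fun (k : 'I_K) _ => muF k)) sumEFin.
Qed.

(* Ties are split evenly, as in [B_S]. *)
Definition half_below (i j : nat) : R :=
  \1_[set x : R | x < 0] (i%:R - j%:R) + 2^-1 * \1_[set (0 : R)] (i%:R - j%:R).

Lemma half_belowE i j :
  half_below i j = if (i < j)%N then 1 else if i == j then 2^-1 else 0.
Proof.
rewrite /half_below !indicE; case: ltngtP => ij.
- rewrite mem_set ?memNset ?mulr0 ?addr0//= ?subr_lt0 ?ltr_nat//.
  by apply/eqP; rewrite subr_eq0 eqr_nat ltn_eqF.
- rewrite !memNset ?mulr0 ?addr0//= ?subr_lt0 ?ltr_nat ?ltnNge ?(ltnW ij)//.
  by apply/eqP; rewrite subr_eq0 eqr_nat gtn_eqF.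
- by rewrite ij subrr memNset ?mem_set ?add0r ?mulr1//= ltxx.
Qed.

(** As [q <= p], the smaller product is the one that gives [p] the smaller exponent; in a tie the
    two halves add up. *)
Lemma min_half_below (p q : R) i j : 0 <= q <= p ->
  Num.min (p ^+ i * q ^+ j) (p ^+ j * q ^+ i) =
  p ^+ i * q ^+ j * half_below i j + p ^+ j * q ^+ i * half_below j i.
Proof.
move=> /andP[q0 qp].
have le m n : (m < n)%N -> p ^+ m * q ^+ n <= p ^+ n * q ^+ m.
  move=> /ltnW mn; rewrite -(subnK mn) !exprD mulrCA -!mulrA ler_wpM2r//.
    by rewrite mulr_ge0// exprn_ge0// (le_trans q0).
  by rewrite lerXn2r ?nnegrE// (le_trans q0).
rewrite !half_belowE; case: ltngtP => [/le ij|/le ji|->].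
- by rewrite min_l// mulr1 mulr0 addr0.
- by rewrite min_r// mulr1 mulr0 add0r.
- by rewrite minxx; field.
Qed.

(* Exchanging [i] and [k - i] turns the second half of the minimum into the
   first one. *)
Lemma overlap_half_below (p q : R) k : 0 <= q <= p ->
  overlap p q k 1 1 = 2 * \sum_(i < k.+1)
    p ^+ i * q ^+ (k - i) * half_below i (k - i) *+ 'C(k, i).
Proof.
move=> qp; rewrite overlapE mulrDl mul1r.
rewrite [X in _ = _ + X](reindex_inj rev_ord_inj) -big_split/=.
apply: eq_bigr => i _; have ik : (i <= k)%N by rewrite -ltnS.
by rewrite !mulr1 min_half_below// subSS subKn// bin_sub// mulrnDl.
Qed.

(** Poisson splitting: the total of the two counts is Poisson of parameter [2 * lambda], and given
    the total [k] the first count is binomial with success probability [(1 + s) / 2]. By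
    [overlap_half_below], the conditional probability of a negative difference, ties halved, is half
    the overlap. *)
Lemma B_S_cvg (alpha lambda : R) (s := s_star alpha) : 0 <= lambda ->
  0 <= s <= 1 ->
  poisson_mix (fun k => overlap ((1 + s) / 2) ((1 - s) / 2) k 1 1) K (2 * lambda)
    @[K --> \oo] --> 2 * B_S alpha lambda.
Proof.
move=> l0 /andP[s0 s1]; rewrite /B_S -/s.
set p := (1 + s) / 2; set q := (1 - s) / 2.
have mu10 : 0 <= lambda * (1 + s) by rewrite mulr_ge0// addr_ge0.
have mu20 : 0 <= lambda * (1 - s) by rewrite mulr_ge0// subr_ge0.
have mneg : measurable [set x : R | x < 0].
  have -> : [set x : R | x < 0] = `]-oo, 0[%classic by rewrite set_itvE.
  exact: measurable_itv.
have -> : (fun K => poisson_mix (fun k => overlap p q k 1 1) K (2 * lambda)) =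
    (fun K => 2 * (skellam_partial (lambda * (1 + s)) (lambda * (1 - s))
        [set x | x < 0] K +
      2^-1 * skellam_partial (lambda * (1 + s)) (lambda * (1 - s)) [set 0] K)).
  apply/funext => K; rewrite /skellam_partial.
  rewrite /poisson_mix !mulr_sumr -[X in _ = _ * X]big_split mulr_sumr.
  apply: eq_bigr => k _ /=.
  rewrite overlap_half_below; last by rewrite /p /q; lra.
  rewrite !mulr_sumr -[X in _ = _ * X]big_split mulr_sumr.
  apply: eq_bigr => i _ /=; have ik : (i <= k)%N by rewrite -ltnS.
  rewrite -[_ *+ 'C(k, i)]mulr_natr /half_below.
  (* With [k!] factored and both rates written as [2 * lambda * p] and [2 * lambda * q], the terms
     agree by a field identity. *)
  have fE : ('C(k, i))%:R * (i`!%:R * (k - i)`!%:R) = k`!%:R :> R.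
    by rewrite -!natrM bin_fact.
  have f0 n : n`!%:R != 0 :> R by rewrite pnatr_eq0 -lt0n fact_gt0.
  have c0 : ('C(k, i))%:R != 0 :> R by rewrite pnatr_eq0 -lt0n bin_gt0.
  rewrite -[in LHS]fE.
  rewrite (_ : - (2 * lambda) = - (lambda * (1 + s)) - lambda * (1 - s)); last ring.
  rewrite expRD.
  have -> : (2 * lambda) ^+ k = (2 * lambda) ^+ i * (2 * lambda) ^+ (k - i).
    by rewrite -exprD subnKC.
  rewrite (_ : lambda * (1 + s) = 2 * lambda * p); last by rewrite /p; field.
  rewrite (_ : lambda * (1 - s) = 2 * lambda * q); last by rewrite /q; field.
  rewrite [(2 * lambda * p) ^+ _]exprMn [(2 * lambda * q) ^+ _]exprMn.
  by field; rewrite c0 !f0.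
apply: cvgMl_tmp; apply: cvgD; first exact: skellam_cvg.
by apply: cvgMl_tmp; exact: skellam_cvg.
Qed.

End skellam_overlap.

(** * From binomial to Poisson mixtures *)

Lemma cvg_inv_nat (R : realType) : (n%:R^-1 : R) @[n --> \oo] --> (0 : R).
Proof.
apply/gtr0_cvgV0; last exact: cvgr_idn.
by near=> n; rewrite ltr0n; near: n; exact: nbhs_infty_gt.
Unshelve. all: by end_near. Qed.

(** Each of the [k] factors of the falling factorial is at least [n - k]. *)
Lemma leq_exp_ffact n k : ((n - k) ^ k <= n ^_ k)%N.
Proof.
elim: k => [|k IHk]; first by rewrite expn0 ffactn0.
rewrite expnSr ffactnSr leq_mul ?leq_sub2l//.
rewrite (leq_trans _ IHk)//; case: k {IHk} => // k.
by rewrite leq_exp2r// leq_sub2l.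
Qed.

(** The inverse of [1 - x] is [1 + x / (1 - x)], at most the exponential of [x / (1 - x)]. *)
Lemma ler_expR_Bx1 (R : realType) (x : R) : x < 1 ->
  expR (- (x / (1 - x))) <= 1 - x.
Proof.
move=> x1; have y0 : 0 < 1 - x by rewrite subr_gt0.
rewrite expRN -[leRHS]invrK lef_pV2 ?posrE ?invr_gt0 ?expR_gt0//.
by rewrite (le_trans _ (expR_ge1Dx _))// le_eqVlt; apply/orP; left;
  apply/eqP; field; rewrite gt_eqF.
Qed.

Section binomial_to_poisson.
Context {R : realType}.
Variables (c : nat -> R) (t : R).
Hypotheses (c0 : forall k, 0 <= c k) (t0 : 0 <= t).

(** The exponential bounds [(1 - t / n) ^+ n], which is at most [(1 - t / n) ^+ (n - k)]; the rest
    comes from [leq_exp_ffact]. As a function of [n^-1], the lower bound is continuous at 0, where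
    it is the Poisson weight. *)
Lemma binomial_weight_ge n k : (k <= n)%N -> (0 < n)%N -> t < n%:R ->
  expR (- (t / (1 - t * n%:R^-1))) * (t ^+ k / k`!%:R * (1 - k%:R * n%:R^-1) ^+ k)
  <= ((t / n%:R) ^+ k * (1 - t / n%:R) ^+ (n - k)) *+ 'C(n, k).
Proof.
move=> kn n0 tn; have n0R : 0 < n%:R :> R by rewrite ltr0n.
have x0 : 0 <= t / n%:R by rewrite divr_ge0.
have x1 : t / n%:R < 1 by rewrite ltr_pdivrMr// mul1r.
have f0 : 0 < k`!%:R :> R by rewrite ltr0n fact_gt0.
have -> : ((t / n%:R) ^+ k * (1 - t / n%:R) ^+ (n - k)) *+ 'C(n, k) =
  (1 - t / n%:R) ^+ (n - k) * (t ^+ k / k`!%:R * ((n ^_ k)%:R / n%:R ^+ k)).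
  rewrite -bin_ffact natrM -mulr_natr expr_div_n; field.
  by rewrite expf_neq0 ?gt_eqF.
apply: ler_pM.
- exact: expR_ge0.
- rewrite mulr_ge0 ?divr_ge0 ?exprn_ge0//.
  by rewrite subr_ge0 ler_pdivrMr// mul1r ler_nat.
- rewrite (@le_trans _ _ ((1 - t / n%:R) ^+ n))//; last first.
    by rewrite ler_wiXn2l ?leq_subr// ?gerBl// subr_ge0 ltW.
  rewrite (_ : expR _ = expR (- (t / n%:R / (1 - t / n%:R))) ^+ n).
    rewrite lerXn2r ?nnegrE ?expR_ge0 ?subr_ge0 ?(ltW x1)//.
    exact: ler_expR_Bx1.
  rewrite -expRM_natr; congr expR; field.
  by rewrite !gt_eqF ?subr_gt0.
- apply: ler_wpM2l; first by rewrite divr_ge0 ?exprn_ge0.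
  rewrite ler_pdivlMr ?exprn_gt0// -exprMn mulrBl mul1r divfK ?gt_eqF//.
  by rewrite -natrB// -natrX ler_nat leq_exp_ffact.
Qed.

(** The first [K] terms are at least [w n^-1], which tends to the truncated Poisson mixture; the
    other terms are nonnegative. *)
Lemma binomial_mix_gt K L : L < poisson_mix c K t -> \forall n \near \oo,
  L < \sum_(k < n.+1)
    (t / n%:R) ^+ k * (1 - t / n%:R) ^+ (n - k) * c k *+ 'C(n, k).
Proof.
pose F k (x : R) := expR (- (t / (1 - t * x))) *
    (t ^+ k / k`!%:R * (1 - k%:R * x) ^+ k) * c k.
pose w (x : R) := \sum_(k < K) F k x.
have wcvg : w n%:R^-1 @[n --> \oo] --> poisson_mix c K t.
  have -> : poisson_mix c K t = w 0.
    rewrite /poisson_mix mulr_sumr; apply: eq_bigr => k _.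
    by rewrite /F !mulr0 subr0 divr1 expr1n mulr1 mulrA.
  apply: continuous_cvg; last exact: cvg_inv_nat.
  rewrite /w /F.
  apply: (cvg_big add_continuous) => k _.
  have cl (s : R) : (1 - s * x) @[x --> (0 : R)] --> 1 - s * 0.
    by apply: cvgB; [exact: cvg_cst|apply: cvgMl_tmp; exact: cvg_id].
  apply: cvgMr_tmp; apply: cvgM; last first.
    apply: cvgMl_tmp; apply: (@continuous_cvg _ _ _ _ _ _ (fun y : R => y ^+ k)) => //.
    exact: exprn_continuous.
  apply: continuous_cvg; first exact: continuous_expR.
  apply: cvgN; apply: cvgMl_tmp; apply: cvgV => //.
  by rewrite mulr0 subr0 oner_eq0.
move=> /(cvgr_gt _ wcvg) Lw.
near=> n.
have n0 : (0 < n)%N by near: n; exact: nbhs_infty_gt.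
have Kn : (K <= n.+1)%N by apply: leqW; near: n; exact: nbhs_infty_ge.
have tn : t < n%:R by near: n; exact: nbhs_infty_gtr.
have : L < w n%:R^-1 by near: n.
move=> /lt_le_trans; apply.
rewrite /w (big_ord_widen _ (F ^~ n%:R^-1) Kn).
rewrite [leRHS](bigID (fun k : 'I_n.+1 => (k < K)%N))/= ler_wpDr//.
  apply: sumr_ge0 => k _; rewrite mulrn_wge0// !mulr_ge0 ?exprn_ge0 ?divr_ge0//.
  by rewrite subr_ge0 ler_pdivrMr ?ltr0n// mul1r ltW.
apply: ler_sum => k _; rewrite -mulrnAl ler_wpM2r// binomial_weight_ge//.
by rewrite -ltnS.
Unshelve. all: by end_near. Qed.

End binomial_to_poisson.

(** * Strict monotonicity of [B_S] *)

Section s_star.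
Context {R : realType}.
Variable alpha : R.
Hypotheses (alpha_gt1 : 1 < alpha) (alpha_lt2 : alpha < 2).

Lemma s_star_gt0 : 0 < s_star alpha.
Proof.
by rewrite /s_star sqrtr_gt0 mulr_gt0 ?subr_gt0// (lt_trans ltr01).
Qed.

Lemma s_star_le1 : s_star alpha <= 1.
Proof.
rewrite /s_star -[leRHS]sqrtr1 ler_wsqrtr//.
have := sqr_ge0 (alpha - 1); rewrite expr2; lra.
Qed.

Lemma B_S_strict_decr (l l' : R) : 0 <= l -> l < l' -> B_S alpha l' < B_S alpha l.
Proof.
move=> l0 ll'; have s0 := s_star_gt0; have s1 := s_star_le1.
set s := s_star alpha in s0 s1; set p := (1 + s) / 2; set q := (1 - s) / 2.
have p0 : 0 <= p by rewrite /p; lra.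
have q0 : 0 <= q by rewrite /q; lra.
have pq : p + q = 1 by rewrite /p /q; field.
pose c k := overlap p q k 1 1.
have c0 k : 0 <= c k by exact: overlap_ge0.
have cS k : c k.+1 <= c k by exact: overlapS_le.
have s01 : 0 <= s <= 1 by rewrite ltW.
have l'0 : 0 <= l' by rewrite (le_trans l0)// ltW.
have h := B_S_cvg l0 s01; have h' := B_S_cvg l'0 s01.
(* Here [c 0 - c 1 = 1 - 2 * q = s > 0]. The gap [g] is the same for all [K], so it survives the
   limit and the inequality stays strict. *)
set g := (c 0%N - c 1%N) * expR (- (2 * l')) * (2 * l' - 2 * l).
have g0 : 0 < g.
  rewrite !mulr_gt0 ?expR_gt0 ?subr_gt0 ?ltr_pM2l//.
  rewrite /c /= !mulr1 minxx (min_r (x := p)) ?(min_l (x := q)); rewrite /p /q; lra.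
suff le2 : 2 * B_S alpha l' + g <= 2 * B_S alpha l.
  by rewrite -(@ltr_pM2l _ 2)// (lt_le_trans _ le2)// ltrDl.
apply: (ler_cvg_to (cvgD h' (cvg_cst g)) h).
near=> K.
have -> : K = K.-2.+2 by rewrite -subn2 -addn2 subnK//; near: K; exact: nbhs_infty_ge.
by apply: poisson_mix_strict_decr => //; lra.
Unshelve. all: by end_near. Qed.

End s_star.

(** * The two-point lower bound *)

Section three_point.
Context d (T : measurableType d) (R : realType).
Variables (a b c : T) (x y z : {nonneg R}).
Hypothesis xyz1 : x%:num + y%:num + z%:num = 1 :> R.
Local Open Scope ereal_scope.

(* The proof argument only serves to attach the probability instance. *)
Definition three_point of (x%:num + y%:num + z%:num = 1 :> R)%R :
    set T -> \bar R :=
  measure_add (measure_add (mscale x \d_a) (mscale y \d_b)) (mscale z \d_c).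

HB.instance Definition _ := Measure.on (three_point xyz1).

Let three_point_setT : three_point xyz1 setT = 1.
Proof.
transitivity (x%:num%:E * \d_a setT + y%:num%:E * \d_b setT +
    z%:num%:E * \d_c setT).
  by rewrite [LHS]measure_addE; congr (_ + _); exact: measure_addE.
by rewrite !diracT !mule1 -!EFinD xyz1.
Qed.

HB.instance Definition _ :=
  Measure_isProbability.Build _ _ _ (three_point xyz1) three_point_setT.

End three_point.

(* No measurable structure is attached to [T] here: in [moment_class] the law
   lives on [measurableTypeR R] while the integral is taken over the default
   measurable structure of [R]. *)
Definition three_point_law (T : Type) (R : realType) (P : set T -> \bar R)
    (a b c : T) (x y z : R) :=
  forall A, P A = (x * (a \in A)%:R + y * (b \in A)%:R + z * (c \in A)%:R)%:E.

Section three_point_law.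
Context d (T : measurableType d) (R : realType).
Variables (a b c : T) (x y z : R).
Hypotheses (x0 : 0 <= x) (y0 : 0 <= y) (z0 : 0 <= z).
Local Open Scope ereal_scope.

Lemma three_point_law_exists : (x + y + z = 1)%R ->
  exists P : probability T R, three_point_law P a b c x y z.
Proof.
move=> xyz1.
exists (@three_point _ T R a b c (NngNum x0) (NngNum y0) (NngNum z0) xyz1).
move=> A; transitivity (x%:E * \d_a A + y%:E * \d_b A + z%:E * \d_c A).
  by rewrite [LHS]measure_addE; congr (_ + _); exact: measure_addE.
by rewrite !diracE -!EFinM -!EFinD.
Qed.

Variable P : set T -> \bar R.
Hypothesis PE : three_point_law P a b c x y z.

(** The set function [P] rebuilt as a sum of scaled Dirac measures, to which additivity of the
    integral in the measure applies. *)
Let mu : {measure set T -> \bar R} := measure_add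
  (measure_add (mscale (NngNum x0) \d_a) (mscale (NngNum y0) \d_b))
  (mscale (NngNum z0) \d_c).

Let P_mu : P = mu.
Proof.
apply/funext => A; rewrite PE [RHS]measure_addE.
transitivity (x%:E * \d_a A + y%:E * \d_b A + z%:E * \d_c A).
  by rewrite !diracE -!EFinM -!EFinD.
by congr (_ + _); rewrite [RHS]measure_addE.
Qed.

Lemma ge0_three_point_integral (f : T -> \bar R) : measurable_fun setT f ->
  (forall t, 0 <= f t) ->
  \int[P]_t f t = x%:E * f a + y%:E * f b + z%:E * f c.
Proof.
move=> mf f0; rewrite P_mu !ge0_integral_measure_add//.
by rewrite !ge0_integral_mscale// !integral_dirac// !diracT !mul1e.
Qed.

Lemma three_point_law_integral (f : T -> R) : measurable_fun setT f ->
  \int[P]_t (f t)%:E = (x * f a + y * f b + z * f c)%:E.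
Proof.
move=> mf; have mEf : measurable_fun setT (EFin \o f) by exact/measurable_EFinP.
rewrite P_mu integralE -P_mu !ge0_three_point_integral//;
  [|exact: measurable_funeneg|exact: measurable_funepos].
have eq t : (f t = Num.max (f t) 0 - Num.max (- f t) 0)%R.
  by case: (leP (f t) 0%R) => h; case: (leP (- f t)%R 0%R) => h'; lra.
rewrite !funeposE !funenegE /= -!EFin_max -!EFinM -!EFinD; congr EFin.
rewrite [in RHS](eq a) [in RHS](eq b) [in RHS](eq c); ring.
Qed.

End three_point_law.

Lemma xsection_tuple_cons d (U : measurableType d) n
    (E : set (n.+1.-tuple U)) (u : U) :
  xsection (tuple_cons @^-1` E) u = [set t | E (tuple_cons (u, t))].
Proof. by apply/seteqP; split => t; rewrite /xsection/= inE. Qed.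

Lemma measurable_preimage_tuple_cons d (T : measurableType d) n
    (E : set (n.+1.-tuple T)) : measurable E -> measurable (tuple_cons @^-1` E).
Proof. by move=> mE; rewrite -[X in measurable X]setTI; exact: measurable_tuple_cons. Qed.

Lemma measurable_tuple_cons_section d (T : measurableType d) n
    (E : set (n.+1.-tuple T)) (u : T) :
  measurable E -> measurable [set t | E (tuple_cons (u, t))].
Proof.
move=> mE; rewrite -xsection_tuple_cons; apply: measurable_xsection.
exact: measurable_preimage_tuple_cons.
Qed.

Lemma iid_law_three_pointS d (T : measurableType d) (R : realType)
    (P : probability T R) (a b c : T) (x y z : R) n (E : set (n.+1.-tuple T)) :
  0 <= x -> 0 <= y -> 0 <= z -> three_point_law P a b c x y z -> measurable E ->
  (iid_law P n.+1 E = x%:E * iid_law P n [set t | E (tuple_cons (a, t))] +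
    y%:E * iid_law P n [set t | E (tuple_cons (b, t))] +
    z%:E * iid_law P n [set t | E (tuple_cons (c, t))])%E.
Proof.
move=> x0 y0 z0 PE mE; rewrite /= /distribution /pushforward /product_measure1/=.
set F := tuple_cons @^-1` E.
have mF : measurable F by exact: measurable_preimage_tuple_cons.
rewrite (ge0_three_point_integral x0 y0 z0 PE
  (f := iid_law P n \o xsection F))/=.
- by rewrite !xsection_tuple_cons.
- exact: measurable_fun_xsection.
- by [].
Qed.

(** * Total error of a test between two three-point laws *)

Section two_point_lower_bound.
Context d (T : measurableType d) (R : realType).
Variables (P Q : probability T R) (a b c : T) (x w p q : R).
Hypotheses (x0 : 0 <= x) (w0 : 0 <= w) (p0 : 0 <= p) (q0 : 0 <= q).
Hypotheses (PE : three_point_law P a b c (x * p) (x * q) w)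
           (QE : three_point_law Q a b c (x * q) (x * p) w).

Lemma fine_iid_lawS (P' : probability T R) (y z : R) n (E : set (n.+1.-tuple T)) :
  0 <= y -> 0 <= z -> three_point_law P' a b c y z w -> measurable E ->
  fine (iid_law P' n.+1 E) =
    y * fine (iid_law P' n [set t | E (tuple_cons (a, t))]) +
    z * fine (iid_law P' n [set t | E (tuple_cons (b, t))]) +
    w * fine (iid_law P' n [set t | E (tuple_cons (c, t))]).
Proof.
move=> y0 z0 P'E mE; rewrite (iid_law_three_pointS y0 z0 w0 P'E mE).
have fin s : iid_law P' n [set t | E (tuple_cons (s, t))] \is a fin_num.
  by apply: fin_num_measure; exact: measurable_tuple_cons_section.
by rewrite !fineD ?fineM ?fin_numM ?fin_numD ?fin_numM.
Qed.

(** General weights [u] and [v] make the induction work: conditioning on the first observation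
    multiplies them by the likelihoods of its value. With no observation left, the error is one of
    [u] and [v]. *)
Lemma binomial_overlap_le_error n u v (E : set (n.-tuple T)) :
  0 <= u -> 0 <= v -> measurable E ->
  binomial_overlap p q x w n u v <=
  u * fine (iid_law P n (~` E)) + v * fine (iid_law Q n E).
Proof.
elim: n u v E => [|n IHn] u v E u0 v0 mE.
  rewrite (_ : binomial_overlap _ _ _ _ _ _ _ = Num.min u v); last first.
    by rewrite /binomial_overlap big_ord1 /= bin0 !mul1r.
  have iid0 (P' : probability T R) (X : set (0.-tuple T)) :
      fine (iid_law P' 0 X) = ([tuple] \in X)%:R.
    by rewrite (_ : iid_law P' 0 X = \d_([tuple] : 0.-tuple T) X)// diracE.
  rewrite !iid0 in_setC; have [ET|nET] := pselect (E [tuple]).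
    by rewrite mem_set//= mulr0 mulr1 add0r ge_min lexx orbT.
  by rewrite memNset//= mulr0 mulr1 addr0 ge_min lexx.
rewrite binomial_overlapS// (fine_iid_lawS _ _ PE) ?(fine_iid_lawS _ _ QE)//;
  try exact: mulr_ge0; last exact: measurableC.
have mEs s := measurable_tuple_cons_section s mE.
have := lerD (lerD
  (IHn (x * p * u) (x * q * v) _ _ _ (mEs a))
  (IHn (x * q * u) (x * p * v) _ _ _ (mEs b)))
  (IHn (w * u) (w * v) _ _ _ (mEs c)).
rewrite ?mulr_ge0// => /(_ isT isT isT isT isT isT)/le_trans; apply.
by rewrite le_eqVlt; apply/orP; left; apply/eqP; ring.
Qed.

End two_point_lower_bound.

(** * From an estimator to a test *)

Section le_cam.
Context {R : realType}.
Variables (alpha sigma beta s a x Delta : R) (n : nat).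
Variable m : n.-tuple (measurableTypeR R) -> measurableTypeR R.
Let p := (1 + s) / 2.
Let q := (1 - s) / 2.
Let mu := x * s * a.
Hypotheses (s01 : 0 <= s <= 1) (x01 : 0 <= x <= 1) (a0 : 0 <= a).
Hypothesis mm : measurable_fun setT m.
Hypothesis level : (worst_case_level alpha sigma m Delta <= beta%:E)%E.
Hypothesis moment : x * p * (a - mu) `^ alpha + x * q * (a + mu) `^ alpha +
  (1 - x) * mu `^ alpha <= sigma `^ alpha.

Let mu_ge0 : 0 <= mu.
Proof. by move: s01 x01 => /andP[? ?] /andP[? ?]; rewrite !mulr_ge0. Qed.

Let mu_le : mu <= a.
Proof.
move: s01 x01 => /andP[? ?] /andP[? ?].
by rewrite /mu ler_piMl// mulr_ile1.
Qed.

Let p_ge0 : 0 <= p.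
Proof. by move: s01 => /andP[? ?]; rewrite /p; lra. Qed.

Let q_ge0 : 0 <= q.
Proof. by move: s01 => /andP[? ?]; rewrite /q; lra. Qed.

Let x_ge0 : 0 <= x. Proof. by case/andP: x01. Qed.

Let w_ge0 : 0 <= 1 - x. Proof. by rewrite subr_ge0; case/andP: x01. Qed.

Let measurable_dist (y : R) : measurable_fun setT (fun z : R => `|z - y| `^ alpha).
Proof.
apply: (measurableT_comp (measurable_powR alpha)).
by apply: measurableT_comp => //; exact: measurable_funB.
Qed.

(** The mean is [x * (p - q) * a = mu], and the atoms lie at distances [a - mu], [a + mu] and [mu]
    from it, as in [moment]. *)
Lemma three_point_moment_class (P : probability (measurableTypeR R) R) :
  three_point_law P a (- a) 0 (x * p) (x * q) (1 - x) ->
  moment_class alpha sigma mu P.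
Proof.
have xp0 := mulr_ge0 x_ge0 p_ge0; have xq0 := mulr_ge0 x_ge0 q_ge0.
move=> PE; split.
  have h := @three_point_law_integral default_measure_display R R _ _ _ _ _ _
    xp0 xq0 w_ge0 _ PE id (@measurable_id _ R setT).
  by apply: (etrans h); congr EFin; rewrite /mu /p /q; field.
have h := @three_point_law_integral default_measure_display R R _ _ _ _ _ _
  xp0 xq0 w_ge0 _ PE _ (measurable_dist mu).
rewrite h lee_fin ger0_norm ?subr_ge0// -opprD normrN ger0_norm ?addr_ge0//.
by rewrite sub0r normrN ger0_norm.
Qed.

(** Mirror image of the previous case: weights and distances are exchanged together, so [moment]
    applies again. *)
Lemma three_point_moment_classN (P : probability (measurableTypeR R) R) :
  three_point_law P a (- a) 0 (x * q) (x * p) (1 - x) ->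
  moment_class alpha sigma (- mu) P.
Proof.
have xp0 := mulr_ge0 x_ge0 p_ge0; have xq0 := mulr_ge0 x_ge0 q_ge0.
move=> PE; split.
  have h := @three_point_law_integral default_measure_display R R _ _ _ _ _ _
    xq0 xp0 w_ge0 _ PE id (@measurable_id _ R setT).
  by apply: (etrans h); congr EFin; rewrite /mu /p /q; field.
have h := @three_point_law_integral default_measure_display R R _ _ _ _ _ _
  xq0 xp0 w_ge0 _ PE _ (measurable_dist (- mu)).
rewrite h lee_fin !opprK add0r (ger0_norm mu_ge0) ger0_norm ?addr_ge0//.
by rewrite (addrC (- a)) distrC ger0_norm ?subr_ge0// (addrC (x * q * _)).
Qed.

Lemma le_cam_bound : Delta < mu -> binomial_overlap p q x (1 - x) n 1 1 <= 2 * beta.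
Proof.
move=> Dmu; have xp0 := mulr_ge0 x_ge0 p_ge0; have xq0 := mulr_ge0 x_ge0 q_ge0.
have [P PE] : exists P : probability (measurableTypeR R) R,
    three_point_law P a (- a) 0 (x * p) (x * q) (1 - x).
  by apply: three_point_law_exists => //; rewrite /p /q; field.
have [Q QE] : exists P : probability (measurableTypeR R) R,
    three_point_law P a (- a) 0 (x * q) (x * p) (1 - x).
  by apply: three_point_law_exists => //; rewrite /p /q; field.
(* The test decides for mean [mu] when the estimate is nonnegative. As [Delta < mu], a wrong
   decision means that the estimate misses the true mean by more than [Delta]. *)
pose E := [set z | 0 <= m z].
have mlt (y : R) : measurable [set z | m z < y].
  rewrite (_ : mkset _ = m @^-1` `]-oo, y[%classic).
    by rewrite -[X in measurable X]setTI; apply: mm => //; exact: measurable_itv.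
  by apply/seteqP; split => z /=; rewrite in_itv.
have mgt (y : R) : measurable [set z | y < m z].
  rewrite (_ : mkset _ = m @^-1` `]y, +oo[%classic).
    by rewrite -[X in measurable X]setTI; apply: mm => //; exact: measurable_itv.
  by apply/seteqP; split => z /=; rewrite in_itv andbT.
have mE : measurable E.
  rewrite (_ : E = ~` [set z | m z < 0]); first exact: measurableC.
  apply/seteqP; split => z; rewrite /E /=.
    by rewrite leNgt => /negP.
  by move=> /negP; rewrite -leNgt.
have := binomial_overlap_le_error x_ge0 w_ge0 p_ge0 q_ge0 PE QE ler01 ler01 mE.
rewrite !mul1r => /le_trans; apply; rewrite mulrDl mul1r.
have finP (P' : probability (measurableTypeR R) R) X :
    measurable X -> iid_law P' n X \is a fin_num.
  by move=> mX; exact: fin_num_measure.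
have := level; rewrite /worst_case_level ge_max => /andP[lr ll].
apply: lerD.
  rewrite -lee_fin fineK; last by apply: finP; exact: measurableC.
  apply: (@le_trans _ _ (iid_law P n [set z | m z < mu - Delta])).
    apply: le_measure; rewrite ?inE//; first exact: measurableC.
    move=> z /= /negP; rewrite -ltNge => /lt_trans; apply.
    by rewrite subr_gt0.
  apply: le_trans ll; apply: ereal_sup_ubound; exists mu; exists P => //.
  exact: three_point_moment_class.
rewrite -lee_fin fineK; last exact: finP.
apply: (@le_trans _ _ (iid_law Q n [set z | - mu + Delta < m z])).
  apply: le_measure; rewrite ?inE//.
  by move=> z /=; apply: lt_le_trans; rewrite addrC subr_lt0.
apply: le_trans lr; apply: ereal_sup_ubound; exists (- mu); exists Q => //.
exact: three_point_moment_classN.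
Qed.

End le_cam.

(** * Choice of the support and limit *)

Section least_favourable_scale.
Context {R : realType}.
Variable alpha : R.
Hypotheses (alpha_gt1 : 1 < alpha) (alpha_lt2 : alpha < 2).

Let alpha_gt0 : 0 < alpha. Proof. exact: lt_trans ltr01 alpha_gt1. Qed.

Lemma scale_factor_le1 (r : R) : 0 < r -> r < 1 ->
  exists2 d : R, 0 < d & forall x, 0 < x -> x < d ->
    x <= 1 /\ r * ((1 + x) ^+ 2 + x `^ (alpha - 1)) <= 1.
Proof.
move=> r0 r1; have b0 : 0 < alpha - 1 by rewrite subr_gt0.
(* For [x <= 1] the bracket is at most [1 + 3 * x + x]^ (alpha - 1)[, hence at most]1 + 4 * e =
   r^-1[once]x[and]x [^ (alpha - 1)] are at most [e]. *)
pose e := (r^-1 - 1) / 4; have e0 : 0 < e.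
  by rewrite divr_gt0// subr_gt0 invf_gt1.
exists (Num.min 1 (Num.min e (e `^ (alpha - 1)^-1))).
  by rewrite !lt_min ltr01 e0 powR_gt0.
move=> x x0; rewrite !lt_min => /and3P[x1 xe xp]; split; first exact: ltW.
have xpe : x `^ (alpha - 1) <= e.
  rewrite (@le_trans _ _ ((e `^ (alpha - 1)^-1) `^ (alpha - 1)))//.
    by rewrite ge0_ler_powR ?nnegrE ?powR_ge0 ?(ltW b0) ?(ltW x0) ?(ltW xp).
  by rewrite -powRrM mulVf ?gt_eqF// powRr1 ?(ltW e0).
have x2 : (1 + x) ^+ 2 <= 1 + 3 * x by rewrite expr2; nra.
rewrite mulrC -ler_pdivlMr// div1r (_ : r^-1 = 1 + 4 * e); last first.
  by rewrite /e; field; rewrite gt_eqF.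
lra.
Qed.

(* The moment constraint would be tight at [r = 1], up to terms vanishing with
   [x]; the factor [r] absorbs them. *)
Lemma scaled_moment_le (sigma s r x : R)
    (a := r * sigma * x `^ (- alpha^-1)) (mu := x * s * a) :
  0 < sigma -> 0 <= s <= 1 -> 0 < r -> r < 1 -> 0 < x -> x <= 1 ->
  r * ((1 + x) ^+ 2 + x `^ (alpha - 1)) <= 1 ->
  x * ((1 + s) / 2) * (a - mu) `^ alpha + x * ((1 - s) / 2) * (a + mu) `^ alpha +
  (1 - x) * mu `^ alpha <= sigma `^ alpha.
Proof.
move=> sg0 /andP[s0 s1] r0 r1 x0 x1 hr.
have a0 : 0 < a by apply: mulr_gt0; [exact: mulr_gt0|exact: powR_gt0].
have mu0 : 0 <= mu by apply: mulr_ge0 (ltW a0); apply: mulr_ge0 (ltW x0) s0.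
have muxa : mu <= x * a by rewrite /mu -mulrA ler_wpM2l ?(ltW x0)// ler_piMl// ltW.
have xaa : x * a <= a by rewrite ler_piMl// ltW.
have xA : x * a `^ alpha = r `^ alpha * sigma `^ alpha.
  rewrite /a !powRM ?mulr_ge0 ?powR_ge0 ?(ltW r0) ?(ltW sg0)//.
  rewrite -powRrM mulNr mulVf ?gt_eqF// powR_inv1 ?(ltW x0)//.
  by rewrite mulrC divfK// gt_eqF.
set A := a `^ alpha in xA.
have A0 : 0 <= A by exact: powR_ge0.
have h1 : (a - mu) `^ alpha <= A.
  rewrite ge0_ler_powR ?nnegrE ?(ltW alpha_gt0) ?subr_ge0 ?(ltW a0)//.
    exact: le_trans xaa.
  by rewrite gerBl.
have h2 : (a + mu) `^ alpha <= A * (1 + x) ^+ 2.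
  apply: (@le_trans _ _ ((a * (1 + x)) `^ alpha)).
    rewrite ge0_ler_powR ?nnegrE ?(ltW alpha_gt0)//; [| |by rewrite mulrDr mulr1 lerD2l mulrC].
      by rewrite addr_ge0// ltW.
    by rewrite mulr_ge0 ?addr_ge0// ltW.
  rewrite powRM ?addr_ge0 ?(ltW a0) ?(ltW x0)// ler_wpM2l//.
  (* The base [1 + x] is at least 1, so the exponent [alpha] may be raised to 2. *)
  rewrite -powR_mulrn ?addr_ge0 ?(ltW x0)// ler_powR ?(ltW alpha_lt2)//.
  by rewrite lerDl ltW.
have h3 : mu `^ alpha <= x * x `^ (alpha - 1) * A.
  apply: (@le_trans _ _ ((x * a) `^ alpha)).
    by rewrite ge0_ler_powR ?nnegrE ?(ltW alpha_gt0)// mulr_ge0// ltW.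
  rewrite powRM ?(ltW a0) ?(ltW x0)//; rewrite -{2}(powRr1 (ltW x0)) -powRD.
    by rewrite subrKC.
  by rewrite subrKC gt_eqF// implyTb.
have w0 : 0 <= x `^ (alpha - 1) by exact: powR_ge0.
have e1 : 1 <= (1 + x) ^+ 2 by rewrite exprn_ege1// lerDl ltW.
apply: (@le_trans _ _ (x * A * ((1 + x) ^+ 2 + x `^ (alpha - 1)))).
  set z := x `^ (alpha - 1) in h3 w0 *; set y := (1 + x) ^+ 2 in h2 e1 *.
  (* Once both atoms get the common bound [A * y], their weights add up to [x]. *)
  apply: (@le_trans _ _ (x * ((1 + s) / 2) * (A * y) +
      x * ((1 - s) / 2) * (A * y) + 1 * (x * z * A))).
    apply: lerD; first apply: lerD.
    - apply: ler_wpM2l; first by rewrite !mulr_ge0 ?invr_ge0 ?addr_ge0// ltW.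
      by rewrite (le_trans h1)// ler_peMr.
    - by apply: ler_wpM2l => //; rewrite !mulr_ge0 ?invr_ge0 ?subr_ge0// ltW.
    - apply: ler_pM => //; [by rewrite subr_ge0|exact: powR_ge0|].
      by rewrite gerBl ltW.
  by rewrite le_eqVlt; apply/orP; left; apply/eqP; field.
rewrite xA -mulrA mulrCA -[leRHS]mulr1 ler_wpM2l ?powR_ge0//.
apply: le_trans hr; apply: ler_wpM2r; first by rewrite addr_ge0// (le_trans ler01).
(* Since [r < 1 < alpha], the power of [r] is at most [r]. *)
rewrite -[leRHS]powRr1 ?(ltW r0)//; apply: ger_powR; last exact: ltW.
by rewrite r0 ltW.
Qed.

(** The mean [x * s * a] scales as [x] to the power [1 - alpha^-1 = (alpha - 1) / alpha], so for
    [x = t / n] the powers of [n] cancel. *)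
Lemma scaled_margin (sigma s r t : R) n : 0 < sigma -> 0 < t -> (0 < n)%N ->
  n%:R `^ ((alpha - 1) / alpha) *
    (t / n%:R * s * (r * sigma * (t / n%:R) `^ (- alpha^-1)) / sigma) =
  s * (r * t `^ ((alpha - 1) / alpha)).
Proof.
move=> sg0 t0 n0; have n0R : 0 < n%:R :> R by rewrite ltr0n.
set x := t / n%:R; have x0 : 0 < x by rewrite divr_gt0.
have -> : t = n%:R * x by rewrite /x mulrC divfK// gt_eqF.
rewrite powRM ?(ltW n0R) ?(ltW x0)//.
have -> : x `^ ((alpha - 1) / alpha) = x * x `^ (- alpha^-1).
  rewrite -{2}(powRr1 (ltW x0)) -powRD ?gt_eqF ?implybT ?subr_gt0 ?invf_lt1//.
  by rewrite mulrBl divff ?gt_eqF// mul1r.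
by field; rewrite gt_eqF.
Qed.

End least_favourable_scale.

Lemma limn_einf_ge (R : realType) (l : \bar R) (u : (\bar R)^nat) :
  (\forall n \near \oo, l <= u n)%E -> (l <= limn_einf u)%E.
Proof.
move=> [N _ lu]; rewrite limn_einf_lim; apply: lime_ge.
  exact: is_cvg_einfs.
exists N => // n /= Nn; apply: le_ereal_inf_tmp => _ [k /= nk <-].
by apply: lu; exact: leq_trans nk.
Qed.

Lemma pinv_notin (T : choiceType) U (dflt : U -> T) (A : set T) (f : T -> U) y :
  ~ (f @` A) y -> 'pinv_dflt A f y = dflt y.
Proof.
move=> h; rewrite /pinv_ splitV oinv_surj.
by case: pselect => // -[x Ax fx]; case: h; exists x.
Qed.

Theorem proposition9 (R : realType) (sigma alpha beta : R)
    (Delta : nat -> R)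
    (m : forall n : nat, n.-tuple (measurableTypeR R) -> measurableTypeR R)
    (sigma_gt0 : 0 < sigma)
    (alpha_gt1 : 1 < alpha) (alpha_lt2 : alpha < 2)
    (beta_gt0 : 0 < beta) (beta_lt_half : beta < 2^-1)
    (Delta_gt0 : forall n : nat, (0 < n)%N -> 0 < Delta n)
    (measurable_m : forall n : nat, (0 < n)%N ->
       measurable_fun [set: n.-tuple (measurableTypeR R)]%classic (m n))
    (level_le : forall n : nat, (0 < n)%N ->
       (worst_case_level alpha sigma (m n) (Delta n) <= beta%:E)%E) :
  ((s_star alpha * (2 * lambda_star alpha beta) `^ ((alpha - 1) / alpha))%:E
   <= limn_einf (fun n : nat =>
        (n%:R `^ ((alpha - 1) / alpha) * (Delta n / sigma))%:E))%E.
Proof.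
have alpha_gt0 : 0 < alpha by exact: lt_trans ltr01 alpha_gt1.
have gamma_gt0 : 0 < (alpha - 1) / alpha by rewrite divr_gt0 ?subr_gt0.
have gamma_le1 : (alpha - 1) / alpha <= 1.
  by rewrite ler_pdivrMr// mul1r gerBl.
have s0 := s_star_gt0 alpha_gt1 alpha_lt2.
have s1 := s_star_le1 alpha.
(* This settles every case in which [lambda_star] takes the value 0. *)
have trivial_bound : (0 <= limn_einf (fun n : nat =>
    (n%:R `^ ((alpha - 1) / alpha) * (Delta n / sigma))%:E))%E.
  apply: limn_einf_ge; exists 1%N => // n /= n0.
  by rewrite lee_fin mulr_ge0 ?powR_ge0// divr_ge0 ?ltW// Delta_gt0.
have [[l0 l0_ge0 B_l0]|notin] :=
  pselect ((B_S alpha @` [set l | 0 <= l])%classic beta); last first.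
  (* Outside the range of [B_S], [lambda_star] takes its default value 0. *)
  by rewrite /lambda_star pinv_notin// mulr0 powR0 ?gt_eqF// mulr0.
have [] := lambda_starP l0_ge0 B_l0.
set l := lambda_star alpha beta; rewrite le_eqVlt => /predU1P[<- _|l_gt0 B_l].
  by rewrite mulr0 powR0 ?gt_eqF// mulr0.
have L0 : 0 <= s_star alpha * (2 * l) `^ ((alpha - 1) / alpha).
  by rewrite mulr_ge0 ?powR_ge0// ltW.
(* It suffices to reach the bound shrunk by any factor [r2 < 1]. Its square root [r] is spent twice:
   in the support point [a], to meet the moment constraint, and in lowering [l] to [r * l], where
   [B_S] exceeds [beta]. *)
apply/lee_mul01Pr; first by rewrite lee_fin.
move=> r2 /andP[r20 r21]; rewrite -EFinM.
pose r := Num.sqrt r2; have r2E : r2 = r * r.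
  by rewrite -expr2 sqr_sqrtr// ltW.
have r0 : 0 < r by rewrite sqrtr_gt0.
have r1 : r < 1 by rewrite -[ltRHS]sqrtr1 ltr_sqrt.
have rl0 : 0 < r * l by rewrite mulr_gt0.
pose t := 2 * (r * l); have t0 : 0 < t by rewrite mulr_gt0.
pose p := (1 + s_star alpha) / 2; pose q := (1 - s_star alpha) / 2.
have p0 : 0 <= p by rewrite divr_ge0// addr_ge0// ltW.
have q0 : 0 <= q by rewrite divr_ge0// subr_ge0.
have s01 : 0 <= s_star alpha <= 1 by rewrite s1 ltW.
have B_rl : 2 * beta < 2 * B_S alpha (r * l).
  rewrite ltr_pM2l// -B_l; apply: B_S_strict_decr => //; first exact: ltW.
  by rewrite gtr_pMl.
(* A single truncation order at which the mixture exceeds [2 * beta] is enough for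
   [binomial_mix_gt]. *)
have [K _ /(_ K (leqnn K)) mixK] := cvgr_gt _ (B_S_cvg (ltW rl0) s01) _ B_rl.
have c0 k : 0 <= overlap p q k 1 1 by exact: overlap_ge0.
have binn := binomial_mix_gt c0 (ltW t0) mixK.
have [d d0 hd] := scale_factor_le1 alpha_gt1 r0 r1.
apply: limn_einf_ge; near=> n.
have n0 : (0 < n)%N by near: n; exact: nbhs_infty_gt.
have x0 : 0 < t / n%:R by rewrite divr_gt0// ltr0n.
have xd : t / n%:R < d.
  rewrite ltr_pdivrMr ?ltr0n// mulrC -ltr_pdivrMr//; near: n.
  exact: nbhs_infty_gtr.
have [x1 hx] := hd _ x0 xd.
have overlap_gt : 2 * beta < binomial_overlap p q (t / n%:R) (1 - t / n%:R) n 1 1.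
  by near: n; exact: binn.
rewrite lee_fin.
set x := t / n%:R in x0 xd x1 hx *.
pose a := r * sigma * x `^ (- alpha^-1).
have a0 : 0 <= a by rewrite !mulr_ge0 ?powR_ge0 ?(ltW r0) ?(ltW sigma_gt0).
have Dn : x * s_star alpha * a <= Delta n.
  rewrite leNgt; apply/negP => Dn.
  have : binomial_overlap p q x (1 - x) n 1 1 <= 2 * beta.
    apply: (le_cam_bound s01 _ a0 (measurable_m n n0) (level_le n n0) _ Dn).
      by rewrite x1 ltW.
    exact: (scaled_moment_le alpha_gt1 alpha_lt2 sigma_gt0 s01 r0 r1 x0 x1 hx).
  by apply/negP; rewrite -ltNge.
apply: (@le_trans _ _ (n%:R `^ ((alpha - 1) / alpha) *
    (x * s_star alpha * a / sigma))); last first.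
  by rewrite ler_wpM2l ?powR_ge0// ler_wpM2r ?invr_ge0 ?(ltW sigma_gt0).
rewrite scaled_margin// r2E /t (mulrCA 2) (powRM _ (ltW r0)); last first.
  by rewrite mulr_ge0 ?(ltW l_gt0).
rewrite mulrCA ler_wpM2l ?(ltW s0)// -mulrA ler_wpM2l ?(ltW r0)//.
(* The second [r] sits under the exponent [(alpha - 1) / alpha <= 1], and such a power of [r < 1] is
   at least [r]. *)
rewrite ler_wpM2r ?powR_ge0// -[leLHS]powRr1 ?(ltW r0)//.
by apply: ger_powR => //; rewrite r0 ltW.
Unshelve. all: by end_near. Qed.
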